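(* Let $F_{\mathrm{Select}}:\mathbb{R}^d\to\{0,1\}$, $F_{\mathrm{Certify}}:\mathbb{R}^d\to\{1,\dots,m\}$ and $F_{\mathrm{Core}}:\mathbb{R}^d\to\{1,\dots,m\}$ be classifiers, let $\sigma_\epsilon>0$, $\alpha\in(0,1)$, let $n_0,n\ge 1$ be integers, and let $F_{\mathrm{ACES}}$ be the compositional classifier built from them (defined in the context). Fix $x\in\mathbb{R}^d$ and let $(\hat c,\hat R)$ be the (random) class and robustness radius returned by the algorithm $\textsc{Certify}(\sigma_\epsilon,x,n_0,n,\alpha)$ described in the context. Then, with confidence at least $1-\alpha$, if $\hat c\neq\oslash$ then $F_{\mathrm{ACES}}(x+\delta)=\hat c$ for all $\delta\in\mathbb{R}^d$ with $\|\delta\|_2\le\hat R$. That is, over the randomness of the sampling in the algorithm, $$\mathbb{P}\Big(\hat c=\oslash\ \text{ or }\ F_{\mathrm{ACES}}(x+\delta)=\hat c\ \text{ for all } \delta\in\mathbb{R}^d \text{ with } \|\delta\|_2\le\hat R\Big)\ \ge\ 1-\alpha .$$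
   Context: All classifiers are measurable functions. For a classifier $F$ on $\mathbb{R}^d$ with values in a finite label set, its smoothed version is $\bar F(x):=\arg\max_c \mathbb{P}_{\epsilon\sim\mathcal N(0,\sigma_\epsilon^2 I)}(F(x+\epsilon)=c)$, where $c$ ranges over the label set and ties are broken by some fixed rule. The labels are $\{0,1\}$ for $F_{\mathrm{Select}}$ and $\{1,\dots,m\}$ for $F_{\mathrm{Certify}}$. The ACES classifier is $$F_{\mathrm{ACES}}(x)=\bar F_{\mathrm{Select}}(x)\cdot \bar F_{\mathrm{Certify}}(x)+(1-\bar F_{\mathrm{Select}}(x))\cdot F_{\mathrm{Core}}(x),$$ with the smoothed classifiers evaluated exactly. $F_{\mathrm{Core}}$ is evaluated deterministically, without smoothing. $\Phi^{-1}$ is the inverse of the standard Gaussian CDF. The symbol $\oslash$ denotes abstention. Subroutines: - $\textsc{SampleWNoise}(F,x,N,\sigma_\epsilon)$ draws $N$ i.i.d. samples $\epsilon_i\sim\mathcal N(0,\sigma_\epsilon^2 I)$ and returns the array of counts of how often $F$ predicts each label on $x+\epsilon_1,\dots,x+\epsilon_N$. The samples in the first round ($n_0$ draws) are independent of those in the second round ($n$ draws). - $\textsc{LowerConfBnd}(k,N,1-\beta)$ returns the one-sided Clopper–Pearson lower confidence bound, at confidence level $1-\beta$, on the success probability $p$ given that $k\sim\mathrm{Binomial}(N,p)$ is observed: it is $0$ if $k=0$, and otherwise the unique $p\in(0,1)$ with $\mathbb{P}(\mathrm{Binomial}(N,p)\ge k)=\beta$. Algorithm $\textsc{Certify}(\sigma_\epsilon,x,n_0,n,\alpha)$: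 1. $\mathrm{counts}^0_S\leftarrow\textsc{SampleWNoise}(F_{\mathrm{Select}},x,n_0,\sigma_\epsilon)$ and $\mathrm{counts}^0_C\leftarrow\textsc{SampleWNoise}(F_{\mathrm{Certify}},x,n_0,\sigma_\epsilon)$. 2. $\hat s\leftarrow 0$ if $\mathrm{counts}^0_S[0]>\mathrm{counts}^0_S[1]$, else $\hat s\leftarrow 1$. $\hat c_A\leftarrow$ the index of the largest entry of $\mathrm{counts}^0_C$. 3. $\mathrm{counts}_S\leftarrow\textsc{SampleWNoise}(F_{\mathrm{Select}},x,n,\sigma_\epsilon)$ and $\mathrm{counts}_C\leftarrow\textsc{SampleWNoise}(F_{\mathrm{Certify}},x,n,\sigma_\epsilon)$. 4. $\underline{p_S}\leftarrow\textsc{LowerConfBnd}(\mathrm{counts}_S[\hat s],n,1-\tfrac{\alpha}{2})$, $\underline{p_A}\leftarrow\textsc{LowerConfBnd}(\mathrm{counts}_C[\hat c_A],n,1-\tfrac{\alpha}{2})$, and $\underline p\leftarrow\min(\underline{p_A},\underline{p_S})$. 5. If $\hat s=1$ and $\underline p>\tfrac12$: return class $\hat c_A$ and radius $\sigma_\epsilon\Phi^{-1}(\underline p)$. Else if $\hat s=0$ and $\underline{p_S}\ge\tfrac12$: return class $F_{\mathrm{Core}}(x)$ and radius $0$. Else if $\hat c_A=F_{\mathrm{Core}}(x)$ and $\underline{p_A}\ge\tfrac12$: return class $\hat c_A$ and radius $0$. Else: return $\oslash$ and radius $0$. *)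

(* Defs.v *)
From HB Require Import structures.
From mathcomp Require Import all_boot all_order all_algebra.
From mathcomp Require Import all_classical all_reals all_analysis.

Set Implicit Arguments.
Unset Strict Implicit.
Unset Printing Implicit Defensive.

Import Order.TTheory GRing.Theory Num.Theory.

Local Open Scope classical_set_scope.
Local Open Scope ring_scope.

(* R^d is 'rV[R]_d, with the product sigma-algebra generated by the coordinate
   maps (as the library does for n.-tuple T); over R this is the Borel
   sigma-algebra. *)
Definition rV_display : measure_display -> measure_display.
Proof. exact. Qed.

Section measurable_rV.
Context {disp : measure_display} {T : measurableType disp} (d : nat).

Definition rV_coord (i : 'I_d) (v : 'rV[T]_d) : T := v ord0 i.

Let rV_set0 : g_sigma_preimage rV_coord set0.
Proof. exact: sigma_algebra0. Qed.

Let rV_setC A : g_sigma_preimage rV_coord A -> g_sigma_preimage rV_coord (~` A).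
Proof. exact: sigma_algebraC. Qed.

Let rV_bigcup (F : (set 'rV[T]_d)^nat) :
  (forall i, g_sigma_preimage rV_coord (F i)) ->
  g_sigma_preimage rV_coord (\bigcup_i (F i)).
Proof. exact: sigma_algebra_bigcup. Qed.

HB.instance Definition _ := @isMeasurable.Build (rV_display disp)
  'rV[T]_d (g_sigma_preimage rV_coord) rV_set0 rV_setC rV_bigcup.

End measurable_rV.

Lemma measurable_fun_rVP disp disp' (T1 : measurableType disp)
    (T2 : measurableType disp') (d : nat) (f : T1 -> 'rV[T2]_d) :
  measurable_fun [set: T1] f <->
  forall i, measurable_fun [set: T1] (fun x => f x ord0 i).
Proof.
split=> [mf i|mf].
  move=> _ A mA; rewrite setTI.
  rewrite -[X in measurable X]setTI.
  apply: (mf measurableT (rV_coord i @^-1` A)).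
  apply: sub_sigma_algebra => /=.
  rewrite -bigcup_seq/=; exists i => /=; first by rewrite mem_index_enum.
  by exists A => //; rewrite setTI.
suff h : g_sigma_preimage (@rV_coord _ T2 d) `<=`
    [set B | measurable (f @^-1` B)].
  by move=> _ B mB; rewrite setTI; exact: h.
apply: smallest_sub.
  split => /=.
  - by rewrite preimage_set0.
  - by move=> B mB; rewrite setTD preimage_setC; exact: measurableC.
  - by move=> F mF; rewrite preimage_bigcup; exact: bigcupT_measurable.
move=> B; rewrite -bigcup_seq/= => -[i _ [A mA <-]].
by rewrite /= setTI -[X in measurable X]setTI; exact: (mf i).
Qed.

Definition rV_cons (R : realType) (d : nat) (p : measurableTypeR R * 'rV[R]_d) : 'rV[R]_d.+1 :=
  \row_i oapp (p.2 ord0) p.1 (unlift ord0 i).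

Lemma measurable_rV_cons (R : realType) (d : nat) :
  measurable_fun [set: measurableTypeR R * 'rV[R]_d] (@rV_cons R d).
Proof.
apply/measurable_fun_rVP => i.
under eq_fun do rewrite mxE.
case: unliftP => [j _|_] /=; last exact: (@measurable_fst _ _ (measurableTypeR R) 'rV[R]_d).
apply: (measurableT_comp (f := fun v : 'rV[R]_d => v ord0 j)); last exact: measurable_snd.
by apply: (measurable_fun_rVP id).1 => //; exact: measurable_id.
Qed.

HB.instance Definition _ (R : realType) (d : nat) :=
  @isMeasurableFun.Build _ _ _ _ (@rV_cons R d) (@measurable_rV_cons R d).

(* N(0, s^2 I_d): the joint law of d independent N(0, s^2) coordinates
   (see isotropic_gaussian_box); normal_prob takes the standard deviation. *)
Fixpoint isotropic_gaussian (R : realType) (s : R) (d : nat) :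
    probability 'rV[R]_d R :=
  if d is d'.+1
  then distribution (normal_prob 0 s \x isotropic_gaussian s d')%E (@rV_cons R d')
  else \d_(0 : 'rV[R]_0).

Lemma isotropic_gaussian_box (R : realType) (s : R) (d : nat)
    (A : 'I_d -> set R) : (forall i, measurable (A i)) ->
  isotropic_gaussian s d [set v | forall i, A i (v ord0 i)] =
  (\prod_(i < d) normal_prob 0 s (A i))%E.
Proof.
elim: d A => [|d IH] A mA.
  by rewrite big_ord0 /= diracE mem_set// => -[].
rewrite big_ord_recl -IH; last by move=> i; exact: mA.
rewrite /= /distribution /pushforward.
rewrite (_ : _ @^-1` _ = A ord0 `*`
  [set v : 'rV[R]_d | forall i, A (lift ord0 i) (v ord0 i)]).
  rewrite product_measure1E//; first exact: (mA ord0).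
  rewrite (_ : [set v | _] = \bigcap_(i in [set: 'I_d])
     ((fun v : 'rV[R]_d => v ord0 i) @^-1` A (lift ord0 i))); last first.
    by apply/seteqP; split=> [v h i _|v h i]; exact: h.
  apply: fin_bigcap_measurable => // i _; rewrite -[X in measurable X]setTI.
  by apply: (measurable_fun_rVP id).1 => //; exact: measurable_id.
apply/seteqP; split=> [[z v] h|[z v] [/= h0 h] i] /=.
  split=> [|i] /=; first by have /= := h ord0; rewrite mxE unlift_none.
  by have /= := h (lift ord0 i); rewrite mxE liftK.
by rewrite mxE; case: unliftP => [j|] ->.
Qed.

Section independence.
Context (disp disp' : measure_display) (Omega : measurableType disp)
  (T : measurableType disp') (R : realType) (P : probability Omega R).

Definition mutually_independent (I : finType) (X : I -> {RV P >-> T}) : Prop :=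
  forall (J : {set I}) (A : I -> set T), (forall i, measurable (A i)) ->
    P (\bigcap_(i in [set` J]) (X i @^-1` A i)) =
    (\prod_(i in J) P (X i @^-1` A i))%E.

Definition sigma_generated (I : Type) (X : I -> {RV P >-> T}) :
    set (set Omega) :=
  <<s \bigcup_(i in [set: I]) preimage_set_system setT (X i) measurable >>.

Definition independent_families (I J : Type)
    (X : I -> {RV P >-> T}) (Y : J -> {RV P >-> T}) : Prop :=
  forall U V : set Omega, sigma_generated X U -> sigma_generated Y V ->
    P (U `&` V) = (P U * P V)%E.

End independence.

Definition join_families (I J X : Type) (f : I -> X) (g : J -> X)
    (k : I + J) : X :=
  match k with inl i => f i | inr j => g j end.

Definition iid_gaussian disp (Omega : measurableType disp) (R : realType)
    (P : probability Omega R) (s : R) (d N : nat)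
    (eps : 'I_N -> {RV P >-> 'rV[R]_d}) : Prop :=
  mutually_independent eps /\
  forall i (A : set 'rV[R]_d), measurable A ->
    distribution P (eps i) A = isotropic_gaussian s d A.

Section classifiers.
Context (R : realType) (d : nat) (L : finType).
Implicit Types (F : 'rV[R]_d -> L) (x : 'rV[R]_d).

Definition measurable_classifier F : Prop :=
  forall C : set L, measurable (F @^-1` C).

(* A tie-breaking rule picks one element of every nonempty set of tied labels. *)
Definition tie_breaking (tie : {set L} -> L) : Prop :=
  forall A : {set L}, A != finset.set0 -> tie A \in A.

Definition argmax_label disp (V : orderType disp) (tie : {set L} -> L)
    (score : L -> V) : L :=
  tie [set c | [forall c', (score c' <= score c)%O]]%SET.

Definition smoothed (s : R) (tie : {set L} -> L) F x : L :=
  argmax_label tie (fun c =>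
    isotropic_gaussian s d [set e : 'rV[R]_d | F (x + e) = c]).

Definition sample_counts F x (N : nat) (eps : 'I_N -> 'rV[R]_d) (c : L) : nat :=
  #|[set i | F (x + eps i) == c]%SET|.

End classifiers.

(* The labels 1, ..., m are the elements of 'I_m, shifted by one; the labels
   0, 1 of the selector are the elements ord0, ord_max of 'I_2. *)
Definition label (m : nat) (c : 'I_m) : nat := c.+1.

Definition aces (R : realType) (d m : nat) (s : R)
    (tieS : {set 'I_2} -> 'I_2) (tieC : {set 'I_m} -> 'I_m)
    (FSelect : 'rV[R]_d -> 'I_2) (FCertify FCore : 'rV[R]_d -> 'I_m)
    (x : 'rV[R]_d) : nat :=
  let sel : nat := smoothed s tieS FSelect x in
  (sel * label (smoothed s tieC FCertify x) + (1 - sel) * label (FCore x))%N.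

Definition l2norm (R : realType) (d : nat) (v : 'rV[R]_d) : R :=
  Num.sqrt (\sum_i v ord0 i ^+ 2).

Definition std_normal_cdf (R : realType) (z : R) : \bar R :=
  normal_prob 0 1 `]-oo, z].

(* Meaningful for p in ]0, 1[, where the preimage is a singleton. *)
Definition std_normal_quantile (R : realType) (p : R) : R :=
  xget 0 [set z : R | std_normal_cdf z = p%:E].

(* For 0 < k <= N and 0 < conf < 1 the set below is a singleton. *)
Definition lower_conf_bnd (R : realType) (k N : nat) (conf : R) : R :=
  if k == 0%N then 0 else
  xget 0 [set p : R | 0 < p < 1 /\
    binomial_prob N p [set j | (k <= j)%N] = (1 - conf)%:E].

(* The procedure as a function of its noise draws: eS0, eC0 are those of the
   first round for the two classifiers, eS, eC those of the second round;
   tieA breaks ties in the largest entry of the first-round counts. The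
   abstention symbol is None. *)
Definition certify (R : realType) (d m : nat) (s : R)
    (tieA : {set 'I_m} -> 'I_m)
    (FSelect : 'rV[R]_d -> 'I_2) (FCertify FCore : 'rV[R]_d -> 'I_m)
    (x : 'rV[R]_d) (n0 n : nat) (alpha : R)
    (eS0 eC0 : 'I_n0 -> 'rV[R]_d) (eS eC : 'I_n -> 'rV[R]_d) :
    option 'I_m * R :=
  let counts0S := sample_counts FSelect x eS0 in
  let counts0C := sample_counts FCertify x eC0 in
  let s_hat : 'I_2 :=
    if (counts0S (ord0) > counts0S (ord_max))%N then ord0 else ord_max in
  let c_hat := argmax_label tieA counts0C in
  let countsS := sample_counts FSelect x eS in
  let countsC := sample_counts FCertify x eC in
  let pS := lower_conf_bnd (countsS s_hat) n (1 - alpha / 2) in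
  let pA := lower_conf_bnd (countsC c_hat) n (1 - alpha / 2) in
  let p := Num.min pA pS in
  if (s_hat == ord_max) && (2^-1 < p) then
    (Some c_hat, s * std_normal_quantile p)
  else if (s_hat == ord0) && (2^-1 <= pS) then (Some (FCore x), 0)
  else if (c_hat == FCore x) && (2^-1 <= pA) then (Some c_hat, 0)
  else (None, 0).

(* Main.v *)
From HB Require Import structures.
Require Import Defs.
From mathcomp Require Import all_boot all_order all_algebra.
From mathcomp Require Import all_classical all_reals all_analysis.
From mathcomp Require Import measurable_realfun normal_distribution.
From mathcomp Require Import binomial_distribution ring lra.
Import Order.TTheory GRing.Theory Num.Theory.
Local Open Scope classical_set_scope.
Local Open Scope ring_scope.
Set Implicit Arguments.
Unset Strict Implicit.
Unset Printing Implicit Defensive.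

(* The certificate can only fail if one of the two Clopper-Pearson bounds of
   the second round reaches the true probability of the label picked in the
   first round. Conditionally on that label, which is independent of the second
   round, this has probability at most alpha / 2: the set of counts k with
   lcb(k) >= p is contained in {k >= k0}, where k0 is its least element, and
   P(Bin(n, p) >= k0) <= P(Bin(n, lcb(k0)) >= k0) = alpha / 2.
   Since the bounds fail to be strict only on these events, outside of them a
   bound >= 1/2 gives a true probability > 1/2, so ties never matter. For a
   positive radius, the Cameron-Martin density of the shifted Gaussian and the
   Neyman-Pearson comparison with a half-space orthogonal to delta show that
   the label keeps probability > 1/2 at x + delta. *)

(** * Gaussian laws on the line *)

(** Valued in [measurableTypeR R] so that preimages and pushforwards are taken in the measurable
    structure on the line. *)
Definition affine (R : realType) (a b x : R) : measurableTypeR R := a * x + b.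

Lemma measurable_affine (R : realType) (a b : R) :
  measurable_fun [set: measurableTypeR R] (affine a b).
Proof. by apply: measurable_funD => //; exact: measurable_funM. Qed.

(** Uniqueness of Lebesgue measure: [|a|] times its pushforward under [affine a b] gives every
    interval ]u, v] its length. *)
Lemma lebesgue_measure_affine (R : realType) (a b : R) (A : set (measurableTypeR R)) :
  a != 0 -> measurable A ->
  (lebesgue_measure A = `|a|%:E * lebesgue_measure (affine a b @^-1` A))%E.
Proof.
move=> a0 mA.
have h := @lebesgue_measure_unique R (mscale (NngNum (normr_ge0 a))
  (pushforward lebesgue_measure (affine a b))).
rewrite (h (measurable_affine a b))//= => _ [[u v] _ <-] /=.
change (lebesgue_measure `]u, v] = `|a|%:E * lebesgue_measure (affine a b @^-1` `]u, v]))%E.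
rewrite lebesgue_measure_itv/=.
have [a_gt0|a_lt0|/eqP] := ltgtP 0 a; last by rewrite eq_sym (negbTE a0).
  rewrite (_ : affine a b @^-1` _ = `](u - b) / a, (v - b) / a]%classic); last first.
    apply/seteqP; split => x /=; rewrite /affine !in_itv/=.
      by rewrite ltr_pdivrMr// ler_pdivlMr// ltrBlDr lerBrDr mulrC.
    by rewrite ltr_pdivrMr// ler_pdivlMr// ltrBlDr lerBrDr mulrC.
  rewrite lebesgue_measure_itv/= !lte_fin ltr_pM2r ?invr_gt0// ltrD2r.
  case: ifPn => _; last by rewrite mule0.
  by rewrite !EFinN -!EFinD -EFinM gtr0_norm//; congr EFin; field.
(* A negative slope swaps the endpoints: the preimage is closed on the left and open on the right,
   with the same length formula. *)
rewrite (_ : affine a b @^-1` _ = `[(v - b) / a, (u - b) / a[%classic); last first.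
  apply/seteqP; split => x /=; rewrite /affine !in_itv/=.
    by rewrite ltr_ndivlMr// ler_ndivrMr// ltrBlDr lerBrDr mulrC andbC.
  by rewrite ltr_ndivlMr// ler_ndivrMr// ltrBlDr lerBrDr mulrC andbC.
rewrite lebesgue_measure_itv/= !lte_fin ltr_nM2r ?invr_lt0// ltrD2r.
case: ifPn => _; last by rewrite mule0.
by rewrite !EFinN -!EFinD -EFinM ltr0_norm//; congr EFin; field.
Qed.

Lemma ge0_integral_affine (R : realType) (a b : R) (f : R -> \bar R) :
  a != 0 -> measurable_fun [set: measurableTypeR R] f -> (forall x, 0 <= f x)%E ->
  (\int[lebesgue_measure]_x f x =
   `|a|%:E * \int[lebesgue_measure]_x f (a * x + b)%R)%E.
Proof.
move=> a0 mf f0.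
rewrite -[X in (_ * X)%E](@ge0_integral_pushforward _ _ _ _ _ _ (@measurable_affine R a b) lebesgue_measure setT f)//.
rewrite -(ge0_integral_mscale _ measurableT (NngNum (normr_ge0 a)))//.
  exact: measurable_affine.
move=> maff; apply: eq_measure_integral => A mA _.
exact: lebesgue_measure_affine.
Qed.

(** By uniqueness of the Radon-Nikodym derivative, [g] agrees with it almost everywhere, so the
    change of variables for that derivative becomes one for [g]. *)
Lemma ge0_integral_density d (T : measurableType d) (R : realType)
    (nu : {finite_measure set T -> \bar R})
    (mu : {sigma_finite_measure set T -> \bar R}) (g : T -> R) (f : T -> \bar R) :
  (forall x, 0 <= g x) -> measurable_fun setT g ->
  (forall A, measurable A -> nu A = \int[mu]_(x in A) (g x)%:E)%E ->
  measurable_fun setT f -> (forall x, 0 <= f x)%E ->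
  (\int[nu]_x f x = \int[mu]_x (f x * (g x)%:E))%E.
Proof.
move=> g0 mg nuE mf f0.
have mEg : measurable_fun setT (fun x => (g x)%:E) by exact/measurable_EFinP.
have nnu : nu `<< mu.
  apply/null_content_dominatesP => A mA muA0.
  rewrite nuE//; apply: null_set_integral => //.
  exact: measurable_funTS.
rewrite -(Radon_Nikodym_SigmaFinite.change_of_variables nnu f0 measurableT)//.
apply: ge0_ae_eq_integral => //.
- apply: emeasurable_funM => //.
  exact: (measurable_int mu (Radon_Nikodym_SigmaFinite.f_integrable nnu)).
- exact: emeasurable_funM.
- by move=> x _; rewrite mule_ge0// Radon_Nikodym_SigmaFinite.f_ge0.
- by move=> x _; rewrite mule_ge0// lee_fin.
have : ae_eq mu setT (Radon_Nikodym_SigmaFinite.f nu mu) (fun x => (g x)%:E).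
  apply: integral_ae_eq => //.
  - exact: Radon_Nikodym_SigmaFinite.f_integrable.
  - by move=> A AE mA; rewrite -nuE// -Radon_Nikodym_SigmaFinite.f_integral.
by apply: filterS => x /= h _; rewrite h.
Qed.

Section normal.
Variable R : realType.
Implicit Types (m s a b x y : R) (A B : set (measurableTypeR R)).
Local Open Scope ereal_scope.

Lemma ge0_integral_normal_prob m s (f : measurableTypeR R -> \bar R) :
  measurable_fun setT f -> (forall x, 0 <= f x) ->
  \int[normal_prob m s]_x f x =
  \int[lebesgue_measure]_x (f x * (normal_pdf m s x)%:E).
Proof.
move=> mf f0; apply: ge0_integral_density => //.
- by move=> x; exact: normal_pdf_ge0.
- exact: measurable_normal_pdf.
Qed.

(** The factor [|a|] is the Jacobian of [affine a b]; the sign of [a * s] is harmless because the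
    density sees only its square. *)
Lemma normal_pdf_affine m s a b x : a != 0%R -> s != 0%R ->
  (`|a| * normal_pdf (a * m + b) (a * s) (a * x + b) = normal_pdf m s x)%R.
Proof.
move=> a0 s0; rewrite !normal_pdfE ?mulf_neq0// mulrA; congr (_ * _)%R.
  rewrite /normal_peak exprMn -mulrA -mulrnAr sqrtrM ?sqr_ge0//.
  rewrite sqrtr_sqr invfM mulrA divff ?normr_eq0// mul1r//.
rewrite /normal_fun; congr expR.
by field; rewrite a0 s0.
Qed.

Lemma normal_prob_affine m s a b A : a != 0%R -> s != 0%R -> measurable A ->
  normal_prob m s (affine a b @^-1` A) = normal_prob (a * m + b) (a * s) A.
Proof.
move=> a0 s0 mA.
rewrite /normal_prob [LHS]integral_mkcond [RHS]integral_mkcond.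
rewrite [RHS](@ge0_integral_affine R a b)//; last 2 first.
- apply/(measurable_restrictT _ mA); apply: measurable_funTS.
  by apply/measurable_EFinP; exact: measurable_normal_pdf.
- by move=> x; rewrite patchE; case: ifPn => // _; rewrite lee_fin normal_pdf_ge0.
rewrite -ge0_integralZl//; last 2 first.
- apply: (measurableT_comp (f := _ \_ A)) => //=; last exact: measurable_affine.
  apply/(measurable_restrictT _ mA); apply: measurable_funTS.
  by apply/measurable_EFinP; exact: measurable_normal_pdf.
- by move=> x _; rewrite patchE; case: ifPn => // _; rewrite lee_fin normal_pdf_ge0.
apply: eq_integral => x _; rewrite !patchE.
have -> : (x \in affine a b @^-1` A) = ((a * x + b)%R \in A) by apply/idP/idP; rewrite !inE.
by case: ifPn => _; rewrite ?mule0// -EFinM normal_pdf_affine.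
Qed.

Lemma ge0_integral_normal_affine m s a b (f : measurableTypeR R -> \bar R) :
  a != 0%R -> s != 0%R -> measurable_fun setT f -> (forall x, 0 <= f x) ->
  \int[normal_prob m s]_x f (a * x + b)%R =
  \int[normal_prob (a * m + b)%R (a * s)%R]_x f x.
Proof.
move=> a0 s0 mf f0.
have maff := @measurable_affine R a b.
transitivity (\int[pushforward (normal_prob m s) (affine a b)]_x f x).
  rewrite (ge0_integral_pushforward maff (normal_prob m s) measurableT mf)//.
apply: eq_measure_integral => A mA _.
exact: normal_prob_affine.
Qed.

Lemma normal_prob_sqr m s t A : (s ^+ 2 = t ^+ 2)%R ->
  normal_prob m s A = normal_prob m t A.
Proof.
move=> st; rewrite /normal_prob; apply: eq_integral => x _.
rewrite /normal_pdf /normal_peak /normal_fun st -(sqrf_eq0 s) st sqrf_eq0.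
by [].
Qed.

(* Completing the square. *)
Lemma normal_pdf_mul s t x y : s != 0%R -> t != 0%R ->
  let c := Num.sqrt (s ^+ 2 + t ^+ 2) in
  (normal_pdf 0 s x * normal_pdf x t y =
   normal_pdf 0 c y * normal_pdf (s ^+ 2 / c ^+ 2 * y) (s * t / c) x)%R.
Proof.
move=> s0 t0 c.
have s2 : (0 < s ^+ 2)%R by rewrite exprn_even_gt0.
have t2 : (0 < t ^+ 2)%R by rewrite exprn_even_gt0.
have c0 : c != 0%R by rewrite gt_eqF// sqrtr_gt0 addr_gt0.
have c2 : (c ^+ 2 = s ^+ 2 + t ^+ 2)%R by rewrite sqr_sqrtr// addr_ge0// ltW.
have cc : (s ^+ 2 + t ^+ 2 != 0)%R by rewrite gt_eqF ?addr_gt0.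
clearbody c; rewrite !normal_pdfE ?mulf_neq0 ?invr_eq0//.
rewrite mulrACA [RHS]mulrACA; congr (_ * _)%R.
  have h (u : R) : (0 <= u ^+ 2 * pi *+ 2)%R.
    by rewrite mulrn_wge0// mulr_ge0 ?sqr_ge0 ?pi_ge0.
  rewrite /normal_peak -!invfM -!sqrtrM//.
  congr (Num.sqrt _)^-1%R.
  rewrite !exprMn exprVn; field.
  exact: c0.
rewrite /normal_fun -!expRD; congr expR.
rewrite !exprMn exprVn c2.
field.
by rewrite ?s0 ?t0 ?cc.
Qed.
End normal.

(** * Centered Gaussians of arbitrary scale and their convolutions *)

Section gauss.
Variable R : realType.
Implicit Types (m s a b x y : R) (A B : set (measurableTypeR R)).
Local Open Scope ereal_scope.

(* normal_prob 0 0 is the uniform law on [0, 1], hence the case split. *)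
Definition centered_gaussian s : probability (measurableTypeR R) R :=
  if s == 0%R then (\d_(0%R : measurableTypeR R) : probability _ R)
  else (normal_prob 0 s : probability _ R).

Lemma centered_gaussian0 :
  centered_gaussian 0 = (\d_(0%R : measurableTypeR R) : probability _ R).
Proof. by rewrite /centered_gaussian eqxx. Qed.

Lemma centered_gaussianE s : s != 0%R -> centered_gaussian s = (normal_prob 0 s : probability _ R).
Proof. by rewrite /centered_gaussian; case: eqP. Qed.

Lemma centered_gaussian_sqr s t A : (s ^+ 2 = t ^+ 2)%R ->
  centered_gaussian s A = centered_gaussian t A.
Proof.
move=> st; have [s0|s0] := eqVneq s 0%R.
  have t0 : t = 0%R by apply/eqP; rewrite -sqrf_eq0 -st s0 expr0n.
  by rewrite s0 t0.
have t0 : t != 0%R by rewrite -sqrf_eq0 -st sqrf_eq0.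
by rewrite !centered_gaussianE//=; exact: normal_prob_sqr.
Qed.

Lemma centered_gaussian_scale a s A : measurable A ->
  centered_gaussian s (affine a 0 @^-1` A) = centered_gaussian (a * s) A.
Proof.
move=> mA; have [->|s0] := eqVneq s 0%R.
  rewrite mulr0 centered_gaussian0/= !diracE; congr (nat_of_bool _)%:R%:E.
  by apply/idP/idP; rewrite !inE/= /affine mulr0 addr0.
have [->|a0] := eqVneq a 0%R.
  rewrite mul0r centered_gaussian0/= diracE /=.
  rewrite (_ : _ @^-1` _ = if 0%R \in A then setT else set0).
    by case: ifPn => _; rewrite ?probability_setT ?measure0.
  apply/seteqP; split => x /=; rewrite /affine mul0r addr0.
    by move=> A0; rewrite mem_set.
  by case: ifPn => //; rewrite inE.
by rewrite !centered_gaussianE ?mulf_neq0//= normal_prob_affine// mulr0 addr0.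
Qed.

(** The law is invariant under x -> -x, so the two closed half-lines at 0 have equal mass, and
    together they cover the line. *)
Lemma centered_gaussian_half s : (2^-1)%:E <= centered_gaussian s [set` `]-oo, 0%R]].
Proof.
set p := centered_gaussian s _.
have mI : measurable ([set` `]-oo, (0 : R)%R]] : set (measurableTypeR R)) by exact: measurable_itv.
have pN : p = centered_gaussian s [set` `[0%R, +oo[].
  have := @centered_gaussian_scale (-1) s _ mI.
  rewrite (centered_gaussian_sqr (t := s)); last by rewrite mulN1r sqrrN.
  rewrite /p => <-; congr (centered_gaussian s _).
  by apply/seteqP; split => x /=; rewrite /affine !in_itv/= addr0 mulN1r andbT oppr_le0.
have : 1 <= p + p.
  rewrite {2}pN -(@probability_setT _ _ _ (centered_gaussian s)).
  rewrite -(setUv `]-oo, 0%R]%classic).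
  apply: le_trans (measureU2 _ _ _) _ => //; first exact: measurableC.
  apply: leeD => //; apply: le_measure; rewrite ?inE//.
    exact: measurableC.
  by move=> x /=; rewrite !in_itv/= andbT => /negP; rewrite -ltNge => /ltW.
have pf : p \is a fin_num by rewrite fin_num_measure.
rewrite -(fineK pf) -EFinD !lee_fin => h.
lra.
Qed.


Lemma measurable_normal_pdf2 s : s != 0%R ->
  measurable_fun setT (fun z : measurableTypeR R * measurableTypeR R => normal_pdf z.1 s z.2).
Proof.
move=> s0.
(* Writing the mean as a translation reduces joint measurability to measurability in the difference
   alone. *)
rewrite (_ : (fun _ => _) = normal_pdf 0 s \o
  (fun z : measurableTypeR R * measurableTypeR R => z.2 - z.1)%R).
  apply: measurableT_comp; first exact: measurable_normal_pdf.
  exact: measurable_funB.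
apply/funext => z /=; rewrite !normal_pdfE//.
by rewrite (normal_fun_center z.1).
Qed.

Lemma centered_gaussian_shift s x A : s != 0%R -> measurable A ->
  centered_gaussian s (affine 1 x @^-1` A) = normal_prob x s A.
Proof.
move=> s0 mA; rewrite centered_gaussianE//= normal_prob_affine//.
by rewrite mulr0 add0r mul1r.
Qed.

(** Needed to integrate over the translation in the convolution formula. For [s = 0] the function is
    an indicator; otherwise it is a partial integral of a jointly measurable density. *)
Lemma measurable_centered_gaussian_shift s A : measurable A ->
  measurable_fun setT
    (fun x : measurableTypeR R => centered_gaussian s (affine 1 x @^-1` A)).
Proof.
move=> mA; have [->|s0] := eqVneq s 0%R.
  rewrite (_ : (fun _ => _) = (fun x => (\1_A x)%:E)).
    exact/measurable_EFinP/measurable_indic.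
  apply/funext => x; rewrite centered_gaussian0/= diracE indicE.
  congr (nat_of_bool _)%:R%:E.
  by apply/idP/idP; rewrite !inE/= /affine mulr0 add0r.
rewrite (_ : (fun _ => _) = (fun x =>
    \int[lebesgue_measure]_y (normal_pdf x s y * \1_A y)%:E)).
  apply: (measurable_fun_fubini_tonelli_F (m2 := lebesgue_measure)
    (fun z : measurableTypeR R * measurableTypeR R => (normal_pdf z.1 s z.2 * \1_A z.2)%:E)).
    apply/measurable_EFinP; apply: measurable_funM; first exact: measurable_normal_pdf2.
    by apply: measurableT_comp => //; exact: measurable_indic.
  by move=> z; rewrite lee_fin mulr_ge0// normal_pdf_ge0.
apply/funext => x; rewrite centered_gaussian_shift// /normal_prob integral_mkcond.
apply: eq_integral => y _; rewrite patchE indicE.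
by case: ifPn => _; rewrite ?mulr1 ?mulr0.
Qed.

(** Variances add. A zero scale gives a Dirac mass and is treated apart; otherwise Tonelli exchanges
    the integrals, and completing the square isolates a normal density in [x], of integral 1. *)
Lemma centered_gaussian_conv s t A : measurable A ->
  \int[centered_gaussian s]_x centered_gaussian t (affine 1 x @^-1` A) =
  centered_gaussian (Num.sqrt (s ^+ 2 + t ^+ 2)) A.
Proof.
move=> mA; have [->|s0] := eqVneq s 0%R.
  rewrite centered_gaussian0 integral_dirac//; last exact: measurable_centered_gaussian_shift.
  rewrite diracT mul1e.
  rewrite (_ : _ @^-1` _ = A).
    by apply: centered_gaussian_sqr; rewrite expr0n add0r sqr_sqrtr// sqr_ge0.
  by apply/seteqP; split => x; rewrite /= /affine mul1r addr0.
have [->|t0] := eqVneq t 0%R.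
  transitivity (\int[centered_gaussian s]_x (\1_A x)%:E).
    apply: eq_integral => x _; rewrite centered_gaussian0/= diracE indicE.
    congr (nat_of_bool _)%:R%:E.
    by apply/idP/idP; rewrite !inE/= /affine mulr0 add0r.
  rewrite integral_indic// setIT.
  by apply: centered_gaussian_sqr; rewrite expr0n addr0 sqr_sqrtr// sqr_ge0.
set c := Num.sqrt _.
have c0 : c != 0%R by rewrite gt_eqF// sqrtr_gt0 addr_gt0// exprn_even_gt0.
rewrite !centered_gaussianE//.
rewrite ge0_integral_normal_prob//; last first.
  apply: (eq_measurable_fun _ _ (measurable_centered_gaussian_shift t mA)).
  by move=> x _; rewrite centered_gaussianE.
pose f (z : measurableTypeR R * measurableTypeR R) :=
  (normal_pdf 0 s z.1 * normal_pdf z.1 t z.2 * \1_A z.2)%:E.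
have f0 z : 0 <= f z.
  by rewrite lee_fin !mulr_ge0// normal_pdf_ge0.
have mf : measurable_fun setT f.
  apply/measurable_EFinP; apply: measurable_funM.
    apply: measurable_funM; last exact: measurable_normal_pdf2.
    by apply: measurableT_comp => //; exact: measurable_normal_pdf.
  by apply: measurableT_comp => //; exact: measurable_indic.
transitivity (\int[lebesgue_measure]_x \int[lebesgue_measure]_y f (x, y)).
  apply: eq_integral => x _.
  rewrite /= normal_prob_affine// mulr0 add0r mul1r.
  rewrite /normal_prob integral_mkcond -ge0_integralZr//.
  - apply: eq_integral => y _; rewrite patchE /f /= indicE.
    case: ifPn => _; rewrite ?mulr1 ?mulr0 ?mul0e//.
    by rewrite -EFinM mulrC.
  - apply/(measurable_restrictT _ mA); apply: measurable_funTS.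
    by apply/measurable_EFinP; exact: measurable_normal_pdf.
  - by move=> y _; rewrite patchE; case: ifPn => // _; rewrite lee_fin normal_pdf_ge0.
  - by rewrite lee_fin normal_pdf_ge0.
rewrite (fubini_tonelli f)//.
rewrite /= /normal_prob [RHS]integral_mkcond.
apply: eq_integral => y _.
rewrite patchE /f/= indicE; case: ifPn => _; last first.
  by under eq_integral do rewrite mulr0; rewrite integral0.
under eq_integral do rewrite mulr1 normal_pdf_mul// EFinM.
rewrite ge0_integralZl//.
- by rewrite integral_normal_pdf mule1.
- by apply/measurable_EFinP; exact: measurable_normal_pdf.
- by move=> x _; rewrite lee_fin normal_pdf_ge0.
- by rewrite lee_fin normal_pdf_ge0.
Qed.

End gauss.

(** * The isotropic Gaussian *)

Section isotropic.
Variable R : realType.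
Implicit Types (s z : R).

Definition dot (d : nat) (u v : 'rV[R]_d) : R := \sum_i u ord0 i * v ord0 i.

Definition rV_tail (d : nat) (v : 'rV[R]_d.+1) : 'rV[R]_d :=
  \row_j v ord0 (lift ord0 j).

Lemma rV_cons0 (d : nat) z (v : 'rV[R]_d) : rV_cons (z, v) ord0 ord0 = z.
Proof. by rewrite mxE unlift_none. Qed.

Lemma rV_consS (d : nat) z (v : 'rV[R]_d) i :
  rV_cons (z, v) ord0 (lift ord0 i) = v ord0 i.
Proof. by rewrite mxE liftK. Qed.

Lemma dot_cons (d : nat) z (u : 'rV[R]_d) (v : 'rV[R]_d.+1) :
  dot (rV_cons (z, u)) v = z * v ord0 ord0 + dot u (rV_tail v).
Proof.
rewrite /dot big_ord_recl rV_cons0; congr (_ + _).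
by apply: eq_bigr => i _; rewrite rV_consS mxE.
Qed.

Lemma dot_tail (d : nat) (v : 'rV[R]_d.+1) :
  dot v v = v ord0 ord0 ^+ 2 + dot (rV_tail v) (rV_tail v).
Proof.
rewrite /dot big_ord_recl -expr2; congr (_ + _).
by apply: eq_bigr => i _; rewrite !mxE.
Qed.

Lemma dotDl (d : nat) (u v w : 'rV[R]_d) : dot (u + v) w = dot u w + dot v w.
Proof. by rewrite -big_split; apply: eq_bigr => i _; rewrite mxE mulrDl. Qed.

Lemma dot_ge0 (d : nat) (v : 'rV[R]_d) : 0 <= dot v v.
Proof. by apply: sumr_ge0 => i _; rewrite -expr2 sqr_ge0. Qed.

Lemma l2normE (d : nat) (v : 'rV[R]_d) : l2norm v = Num.sqrt (dot v v).
Proof. by congr Num.sqrt; apply: eq_bigr => i _; rewrite expr2. Qed.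

Lemma l2norm_sqr (d : nat) (v : 'rV[R]_d) : l2norm v ^+ 2 = dot v v.
Proof. by rewrite l2normE sqr_sqrtr// dot_ge0. Qed.

Lemma l2norm_eq0 (d : nat) (v : 'rV[R]_d) : l2norm v = 0 -> v = 0.
Proof.
move=> v0; have /eqP : dot v v = 0 by rewrite -l2norm_sqr v0 expr0n.
rewrite psumr_eq0; last by move=> i _; rewrite -expr2 sqr_ge0.
move=> /allP h; apply/rowP => i; rewrite mxE; apply/eqP.
by have := h i (mem_index_enum i); rewrite mulf_eq0 orbb.
Qed.

Lemma rV_cons_shift (d : nat) z (v : 'rV[R]_d) (h : 'rV[R]_d.+1) :
  rV_cons (z, v) + h = rV_cons (z + h ord0 ord0, v + rV_tail h).
Proof.
apply/rowP => i; rewrite [LHS]mxE.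
case: (unliftP ord0 i) => [j ->|->]; last by rewrite !rV_cons0.
by rewrite !rV_consS !mxE.
Qed.

Lemma measurable_rV_coord (d : nat) (i : 'I_d) :
  measurable_fun [set: 'rV[R]_d] (fun v : 'rV[R]_d => v ord0 i : measurableTypeR R).
Proof. by apply: (measurable_fun_rVP id).1 => //; exact: measurable_id. Qed.

Lemma measurable_rV_shift (d : nat) (h : 'rV[R]_d) :
  measurable_fun [set: 'rV[R]_d] (fun v : 'rV[R]_d => v + h).
Proof.
apply/measurable_fun_rVP => i.
under eq_fun do rewrite mxE.
apply: measurable_funD => //; exact: measurable_rV_coord.
Qed.

Lemma measurable_dot (d : nat) (h : 'rV[R]_d) :
  measurable_fun [set: 'rV[R]_d] (fun v : 'rV[R]_d => dot v h).
Proof.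
apply: measurable_sum => i; apply: measurable_funM => //.
exact: measurable_rV_coord.
Qed.

Local Open Scope ereal_scope.

Lemma ge0_integral_isotropicS s (d : nat) (f : 'rV[R]_d.+1 -> \bar R) :
  measurable_fun setT f -> (forall v, 0 <= f v) ->
  \int[isotropic_gaussian s d.+1]_v f v =
  \int[normal_prob 0 s]_z \int[isotropic_gaussian s d]_v f (rV_cons (z, v)).
Proof.
move=> mf f0.
rewrite ge0_integral_distribution// (fubini_tonelli1 (f \o _))//.
  by apply: measurableT_comp => //; exact: measurable_rV_cons.
by move=> v; exact: f0.
Qed.

Lemma isotropic_gaussianS s (d : nat) (A : set 'rV[R]_d.+1) : measurable A ->
  isotropic_gaussian s d.+1 A =
  \int[normal_prob 0 s]_z isotropic_gaussian s d [set v | A (rV_cons (z, v))].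
Proof.
move=> mA; apply: eq_integral => z _ /=; congr (isotropic_gaussian s d _).
by apply/seteqP; split => v /=; rewrite /xsection/= inE.
Qed.

(** Induction on the dimension: the first coordinate and the tail contribute independent Gaussians,
    whose variances add under convolution. Zero scales do occur, when coordinates of [h] vanish,
    hence [centered_gaussian]. *)
Lemma isotropic_gaussian_dot s (d : nat) (h : 'rV[R]_d) (A : set (measurableTypeR R)) :
  s != 0%R -> measurable A ->
  isotropic_gaussian s d [set v | A (dot v h)] = centered_gaussian (s * l2norm h) A.
Proof.
move=> s0; elim: d h A => [|d IH] h A mA.
  rewrite /= diracE l2normE /dot !big_ord0 sqrtr0 mulr0 centered_gaussian0/= diracE.
  congr (nat_of_bool _)%:R%:E.
  by apply/idP/idP; rewrite !inE/= big_ord0.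
have mdot : measurable_fun setT (fun v : 'rV[R]_d.+1 => dot v h : measurableTypeR R).
  exact: measurable_dot.
rewrite isotropic_gaussianS; last by rewrite -[X in measurable X]setTI; exact: mdot.
set a := h ord0 ord0; set r := (s * l2norm (rV_tail h))%R.
have mg := measurable_centered_gaussian_shift r mA.
transitivity (\int[normal_prob 0 s]_z centered_gaussian r (affine 1 (affine a 0 z) @^-1` A)).
  apply: eq_integral => z _; rewrite -IH.
    congr (isotropic_gaussian s d _); apply/seteqP.
    by split => v /=; rewrite /affine dot_cons mul1r addr0 mulrC addrC.
  by rewrite -[X in measurable X]setTI; exact: measurable_affine.
transitivity (\int[pushforward (normal_prob 0 s) (affine a 0)]_y
    centered_gaussian r (affine 1 y @^-1` A)).
  rewrite (ge0_integral_pushforward (@measurable_affine R a 0) (normal_prob 0 s) measurableT mg)//.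
transitivity (\int[centered_gaussian (a * s)]_y
    centered_gaussian r (affine 1 y @^-1` A)).
  apply: eq_measure_integral => [|maff B mB _]; first exact: measurable_affine.
  transitivity (centered_gaussian s (affine a 0 @^-1` B)).
    by rewrite centered_gaussianE.
  exact: centered_gaussian_scale.
rewrite centered_gaussian_conv//; apply: centered_gaussian_sqr.
rewrite sqr_sqrtr ?addr_ge0 ?sqr_ge0// !exprMn !l2norm_sqr dot_tail.
by rewrite mulrDr mulrC.
Qed.

(** For nonzero [s], the Cameron-Martin density of the law of [v + h] with respect to the law of
    [v]. *)
Definition gaussian_shift_density s (d : nat) (h v : 'rV[R]_d) : R :=
  expR ((dot v h - dot h h / 2) / s ^+ 2).

Lemma measurable_gaussian_shift_density s (d : nat) (h : 'rV[R]_d) :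
  measurable_fun setT (gaussian_shift_density s h).
Proof.
apply: measurableT_comp => //; apply: measurable_funM => //.
by apply: measurable_funB => //; exact: measurable_dot.
Qed.

(** Translation moves the mean from 0 to [h], and the exponential is the ratio of the two normal
    densities. *)
Lemma normal_prob_shift s (h : R) (f : measurableTypeR R -> \bar R) : s != 0%R ->
  measurable_fun setT f -> (forall x, 0 <= f x) ->
  \int[normal_prob 0 s]_x f (x + h)%R =
  \int[normal_prob 0 s]_x (f x * (expR ((x * h - h ^+ 2 / 2) / s ^+ 2))%:E).
Proof.
move=> s0 mf f0.
transitivity (\int[normal_prob 0 s]_x f (1 * x + h)%R).
  by apply: eq_integral => x _; rewrite mul1r.
rewrite (ge0_integral_normal_affine 0 h (oner_neq0 R) s0 mf f0) mulr0 add0r mul1r.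
rewrite !ge0_integral_normal_prob//; last 2 first.
- apply: emeasurable_funM => //; apply/measurable_EFinP.
  apply: measurableT_comp => //; apply: measurable_funM => //.
  by apply: measurable_funB => //; exact: measurable_funM.
- by move=> x; rewrite mule_ge0// lee_fin expR_ge0.
apply: eq_integral => x _; rewrite -muleA -EFinM; congr (_ * _%:E).
rewrite !normal_pdfE// mulrCA; congr (_ * _)%R.
by rewrite /normal_fun -expRD; congr expR; field.
Qed.

(** Induction on the dimension: the tail is shifted in the inner integral and the first coordinate
    in the outer one; the two exponents add up. *)
Lemma isotropic_gaussian_shift s (d : nat) (h : 'rV[R]_d) (f : 'rV[R]_d -> \bar R) :
  s != 0%R -> measurable_fun setT f -> (forall v, 0 <= f v) ->
  \int[isotropic_gaussian s d]_v f (v + h)%R =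
  \int[isotropic_gaussian s d]_v (f v * (gaussian_shift_density s h v)%:E).
Proof.
move=> s0; elim: d h f => [|d IH] h f mf f0.
  apply: eq_integral => v _.
  rewrite /gaussian_shift_density /dot !big_ord0 mul0r subr0 mul0r expR0 mule1.
  by congr f; apply/rowP; case.
have mc : measurable_fun setT (fun p : measurableTypeR R * 'rV[R]_d => f (rV_cons p)).
  by apply: measurableT_comp => //; exact: measurable_rV_cons.
have mcz z : measurable_fun setT (fun v : 'rV[R]_d => f (rV_cons (z, v))).
  by apply: (measurableT_comp mc); exact: measurable_pair1.
rewrite ge0_integral_isotropicS//; last first.
  by apply: measurableT_comp => //; exact: measurable_rV_shift.
(* [g] is the inner integral once the tail has been shifted; the one-dimensional formula is then
   applied to [g]. *)
pose g (z : measurableTypeR R) := \int[isotropic_gaussian s d]_v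
  (f (rV_cons (z, v)) * (gaussian_shift_density s (rV_tail h) v)%:E).
have mg : measurable_fun setT g.
  apply: (measurable_fun_fubini_tonelli_F (m2 := isotropic_gaussian s d)
    (fun p : measurableTypeR R * 'rV[R]_d =>
      f (rV_cons p) * (gaussian_shift_density s (rV_tail h) p.2)%:E)).
    apply: emeasurable_funM => //; apply/measurable_EFinP.
    by apply: measurableT_comp => //; exact: measurable_gaussian_shift_density.
  by move=> p; rewrite mule_ge0// lee_fin expR_ge0.
have g0 z : 0 <= g z.
  by apply: integral_ge0 => v _; rewrite mule_ge0// lee_fin expR_ge0.
transitivity (\int[normal_prob 0 s]_z g (z + h ord0 ord0)%R).
  apply: eq_integral => z _.
  under eq_integral do rewrite rV_cons_shift.
  exact: (IH (rV_tail h) _ (mcz (z + h ord0 ord0)%R) (fun v => f0 _)).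
rewrite normal_prob_shift// ge0_integral_isotropicS; last 2 first.
- apply: emeasurable_funM => //; apply/measurable_EFinP.
  exact: measurable_gaussian_shift_density.
- by move=> v; rewrite mule_ge0// lee_fin expR_ge0.
apply: eq_integral => z _; rewrite /g -ge0_integralZr//; last 2 first.
- apply: emeasurable_funM => //; apply/measurable_EFinP.
  exact: measurable_gaussian_shift_density.
- by move=> v _; rewrite mule_ge0// lee_fin expR_ge0.
apply: eq_integral => v _; rewrite -muleA -EFinM; congr (_ * _%:E).
rewrite /gaussian_shift_density -expRD; congr expR.
by rewrite dot_cons dot_tail; field.
Qed.

End isotropic.

(** * Neyman-Pearson comparison and the mass of shifted sets *)

Section neyman_pearson.
Context d (T : measurableType d) (R : realType) (P : probability T R).
Local Open Scope ereal_scope.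

(* The Neyman-Pearson comparison: replacing H \ A by the more likely A \ H, where w >= t, increases the integral. *)
Lemma neyman_pearson (w : T -> R) (t : R) (A H : set T) :
  measurable_fun setT w -> (forall x, 0 <= w x)%R -> (0 < t)%R ->
  measurable A -> measurable H ->
  (forall x, H x -> w x <= t)%R -> (forall x, ~ H x -> t <= w x)%R ->
  \int[P]_(x in A) (w x)%:E < +oo -> P H < P A ->
  \int[P]_(x in H) (w x)%:E < \int[P]_(x in A) (w x)%:E.
Proof.
move=> mw w0 t0 mA mH wH wnH Afin PHA.
have mEw D : measurable_fun D (fun x => (w x)%:E).
  by apply: measurable_funTS; exact/measurable_EFinP.
have Ew0 x : 0 <= (w x)%:E by rewrite lee_fin.
have split_int B C : measurable B -> measurable C ->
    \int[P]_(x in B) (w x)%:E =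
    \int[P]_(x in B `&` C) (w x)%:E + \int[P]_(x in B `\` C) (w x)%:E.
  move=> mB mC; rewrite -ge0_integral_setU//; last 3 first.
  - exact: measurableI.
  - exact: measurableD.
  - by apply/disj_set2P; rewrite setDE setIACA setICr setI0.
  by rewrite setUIDK.
have mAH := measurableI A H mA mH.
have mAdH := measurableD mA mH.
have mHdA := measurableD mH mA.
rewrite (split_int A H)// (split_int H A)// (setIC H A).
(* Finiteness allows the common part to be cancelled from a strict inequality. *)
have Ifin : \int[P]_(x in A `&` H) (w x)%:E \is a fin_num.
  rewrite ge0_fin_numE; last exact: integral_ge0.
  apply: le_lt_trans Afin; apply: ge0_subset_integral => //.
rewrite lteD2lE//.
apply: (@le_lt_trans _ _ (t%:E * P (H `\` A))).
  rewrite -integral_cst//; apply: ge0_le_integral => //.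
  by move=> x [Hx _]; rewrite lee_fin wH.
apply: (@lt_le_trans _ _ (t%:E * P (A `\` H))); last first.
  rewrite -integral_cst//; apply: ge0_le_integral => //.
  - by move=> x _; rewrite lee_fin ltW.
  - by move=> x [_ Hx]; rewrite lee_fin wnH.
rewrite lte_pmul2l//.
move: PHA.
rewrite (measureDI P mA mH) (measureDI P mH mA) (setIC H A).
by rewrite lteD2rE// fin_num_measure.
Qed.

End neyman_pearson.

Section certified_shift.
Variable R : realType.
Implicit Types (s z : R).
Local Open Scope ereal_scope.

Lemma std_normal_cdf_ge0 z : (0 <= z)%R -> (2^-1)%:E <= std_normal_cdf z.
Proof.
move=> z0; have := @centered_gaussian_half R 1.
rewrite centered_gaussianE//= => /le_trans; apply.
apply: le_measure; rewrite ?inE; [exact: measurable_itv..|].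
by move=> x /=; rewrite !in_itv/= => /le_trans; apply.
Qed.

(* Cohen's theorem: the half-space orthogonal to h is the least favourable set of given mass for the shift by h. *)
Lemma isotropic_gaussian_shift_gt_half s z (d : nat) (h : 'rV[R]_d) (A : set 'rV[R]_d) :
  (0 < s)%R -> measurable A -> (l2norm h <= s * z)%R ->
  std_normal_cdf z < isotropic_gaussian s d A ->
  (2^-1)%:E < isotropic_gaussian s d [set v | A (v + h)%R].
Proof.
move=> s0 mA hz zA.
have s_neq0 : s != 0%R by rewrite gt_eqF.
have h0 : (0 <= l2norm h)%R by rewrite sqrtr_ge0.
have [/l2norm_eq0 ->|hn0] := eqVneq (l2norm h) 0%R.
  rewrite (_ : [set v | _] = A); last by apply/seteqP; split => v /=; rewrite addr0.
  apply: le_lt_trans zA; apply: std_normal_cdf_ge0.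
  by rewrite -(pmulr_rge0 _ s0); exact: le_trans hz.
have hgt0 : (0 < l2norm h)%R by rewrite lt_neqAle eq_sym hn0.
have s2 : (0 < s ^+ 2)%R by rewrite exprn_gt0.
(* [dot v h] is Gaussian with standard deviation [s * l2norm h], so this threshold gives [H] the
   mass [std_normal_cdf z]. *)
pose r := (s * l2norm h * z)%R.
pose H := [set v : 'rV[R]_d | [set` `]-oo, r]] (dot v h)].
have mI u : measurable ([set` `]-oo, u]] : set (measurableTypeR R)) by exact: measurable_itv.
have mH : measurable H.
  rewrite -[X in measurable X]setTI; apply: (measurable_dot h) => //.
have PH : isotropic_gaussian s d H = std_normal_cdf z.
  rewrite isotropic_gaussian_dot// centered_gaussianE; last by rewrite mulf_neq0.
  rewrite /std_normal_cdf -[X in normal_prob X _ _ = _](mulr0 (s * l2norm h)%R).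
  rewrite -[X in normal_prob X _ _ = _]addr0 -[X in normal_prob _ X _ = _]mulr1.
  rewrite -normal_prob_affine ?mulf_neq0//.
  congr (normal_prob 0 1 _); apply/seteqP; split => x /=;
    by rewrite /affine addr0 !in_itv/= /r ler_pM2l// mulr_gt0.
(* Cameron-Martin for an indicator: the mass of the translated set is the integral of the density
   over [B]. *)
have shiftE B : measurable B -> isotropic_gaussian s d [set v | B (v + h)%R] =
    \int[isotropic_gaussian s d]_(v in B) (gaussian_shift_density s h v)%:E.
  move=> mB.
  have mI1 : measurable_fun setT (fun v => (\1_B v)%:E : \bar R).
    exact/measurable_EFinP/measurable_indic.
  have := isotropic_gaussian_shift h s_neq0 mI1.
  have mB' : measurable [set v | B (v + h)%R].
    by rewrite -[X in measurable X]setTI; exact: (measurable_rV_shift h).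
  move=> e; rewrite [RHS]integral_mkcond.
  transitivity (\int[isotropic_gaussian s d]_v (\1_B (v + h)%R)%:E).
    by rewrite (integral_indic _ measurableT mB') setIT.
  rewrite e => [|v]; last by rewrite lee_fin.
  apply: eq_integral => v _; rewrite patchE indicE.
  by case: ifPn => _; rewrite ?mul1e ?mul0e.
have mw := measurable_gaussian_shift_density s h.
(* The density increases with [dot v h]; [t] is its value on the boundary of [H], so [H] is where it
   is at most [t]. *)
pose t := expR ((r - dot h h / 2) / s ^+ 2).
have leexp u u' : (u <= u')%R ->
    (expR ((u - dot h h / 2) / s ^+ 2) <= expR ((u' - dot h h / 2) / s ^+ 2))%R.
  by move=> uu'; rewrite ler_expR ler_pM2r ?invr_gt0// lerD2r.
have NP := @neyman_pearson _ _ _ (isotropic_gaussian s d)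
  (gaussian_shift_density s h) t A H mw.
rewrite shiftE//; apply: le_lt_trans (NP _ _ _ _ _ _ _ _) => //.
- rewrite -shiftE//.
  (* The translate of [H] contains the half-space [dot v h <= 0], of mass at least 1/2, because the
     norm bound gives [l2norm h ^+ 2 <= r]. *)
  have := centered_gaussian_half (s * l2norm h)%R.
  rewrite -isotropic_gaussian_dot// => /le_trans; apply.
  apply: le_measure; rewrite ?inE.
  + by rewrite -[X in measurable X]setTI; apply: (measurable_dot h).
  + by rewrite -[X in measurable X]setTI; exact: (measurable_rV_shift h).
  + move=> v; rewrite /H /= !in_itv/= => v0.
    rewrite dotDl -l2norm_sqr -(add0r r) lerD// /r mulrAC expr2.
    by rewrite ler_pM2r.
- by move=> v; rewrite expR_ge0.
- exact: expR_gt0.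
- by move=> v; rewrite /H /= in_itv/= => vr; exact: leexp.
- by move=> v; rewrite /H /= in_itv/= => /negP; rewrite -ltNge => /ltW vr; exact: leexp.
- rewrite -shiftE// -ge0_fin_numE// fin_num_measure//.
  by rewrite -[X in measurable X]setTI; exact: (measurable_rV_shift h).
- by rewrite PH.
Qed.

End certified_shift.

(** * Clopper-Pearson bounds *)

Section binomial_tail.
Variable R : realType.
Implicit Types p q : R.

(** Real-valued and defined for every real [p], so that the recurrences hold without a range
    condition. *)
Definition binomial_tail (n k : nat) p : R := \sum_(k <= j < n.+1) binomial_pmf n p j.

Lemma binomial_pmfE (n j : nat) p :
  binomial_pmf n p j = p ^+ j * (1 - p) ^+ (n - j) *+ 'C(n, j).
Proof. by []. Qed.

(** Conditioning on one trial, by Pascal's rule. *)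
Lemma binomial_pmfS (n j : nat) p :
  binomial_pmf n.+1 p j.+1 = p * binomial_pmf n p j + (1 - p) * binomial_pmf n p j.+1.
Proof.
rewrite !binomial_pmfE subSS binS mulrnDr addrC !mulrnAr; congr (_ + _).
  by rewrite exprS mulrA.
(* For [n <= j] the binomial coefficient at [j.+1] vanishes, so the truncated exponent is
   harmless. *)
have [jn|nj] := ltnP j n; last by rewrite bin_small// !mulr0n.
by rewrite -[in LHS](subnSK jn) (exprS (1 - p)) mulrCA.
Qed.

Lemma binomial_tailS (n k : nat) p :
  binomial_tail n.+1 k.+1 p = p * binomial_tail n k p + (1 - p) * binomial_tail n k.+1 p.
Proof.
rewrite /binomial_tail big_add1 /=.
under eq_bigr do rewrite binomial_pmfS.
rewrite big_split /= -!mulr_sumr; congr (_ + _ * _).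
rewrite -(big_add1 _ _ k n.+2 predT (binomial_pmf n p)).
have [kn|nk] := leqP k n; last by rewrite !big_geq// ltnS ltnW.
by rewrite big_nat_recr//= [X in _ + X]binomial_pmfE bin_small// mulr0n addr0.
Qed.

Lemma binomial_tail0 (n : nat) p : binomial_tail n 0 p = 1.
Proof.
rewrite /binomial_tail big_mkord.
under eq_bigr do rewrite binomial_pmfE mulrC.
by rewrite -exprDn subrK expr1n.
Qed.

Lemma binomial_tail_anti (n k : nat) p : 0 <= p <= 1 ->
  binomial_tail n k.+1 p <= binomial_tail n k p.
Proof.
move=> p01; rewrite /binomial_tail.
have [kn|nk] := leqP k n; last by rewrite !big_geq// ltnS ltnW.
by rewrite [leRHS]big_ltn// lerDr binomial_pmf_ge0.
Qed.

(** Induction on the number of trials: one more trial mixes the tails at [k] and [k.+1] with weights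
    [p] and [1 - p], and a larger [p] favours the larger of the two. *)
Lemma binomial_tail_mono (n k : nat) p q : 0 <= p -> p <= q -> q <= 1 ->
  binomial_tail n k p <= binomial_tail n k q.
Proof.
move=> p0 pq q1.
elim: n k => [|n IH] [|k]; rewrite ?binomial_tail0//.
  by rewrite /binomial_tail !big_geq.
rewrite !binomial_tailS.
have p1 : p <= 1 by lra.
have q0 : 0 <= q by lra.
have /= h := @binomial_tail_anti n k q.
have {}h : binomial_tail n k.+1 q <= binomial_tail n k q by apply: h; rewrite q0.
have i1 := ler_wpM2l p0 (IH k).
have i2 : (1 - p) * binomial_tail n k.+1 p <= (1 - p) * binomial_tail n k.+1 q.
  by apply: ler_wpM2l => //; lra.
apply: (le_trans (lerD i1 i2)).
(* The remaining gap: weight [q - p] moves from the tail at [k.+1] to the larger tail at [k]. *)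
have : 0 <= (q - p) * (binomial_tail n k q - binomial_tail n k.+1 q).
  by apply: mulr_ge0; lra.
lra.
Qed.

Lemma binomial_tail_ordE (n k : nat) p :
  binomial_tail n k p = \sum_(j < n.+1 | (k <= j)%N) binomial_pmf n p j.
Proof. by rewrite /binomial_tail (big_nat_widenl k 0)//= big_mkord. Qed.

Lemma binomial_prob_tail (n k : nat) p : 0 <= p <= 1 ->
  binomial_prob n p [set j | (k <= j)%N] = (binomial_tail n k p)%:E.
Proof.
move=> /andP[p0 p1]; rewrite (@binomial_probE R n p p0 p1) binomial_tail_ordE.
rewrite -sumEFin [RHS]big_mkcond/=; apply: eq_bigr => j _; rewrite diracE.
rewrite (_ : (_ \in _) = (k <= j)%N); last by apply/idP/idP; rewrite inE.
by case: ifP => _; rewrite ?mule1 ?mule0.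
Qed.

(** Summing over the set of successful trials is the form in which independence delivers the law of
    a count. *)
Lemma binomial_tail_setE (n k : nat) p :
  binomial_tail n k p =
  \sum_(J : {set 'I_n} | (k <= #|J|)%N) p ^+ #|J| * (1 - p) ^+ (n - #|J|).
Proof.
(* Sets are grouped by cardinality; [inord] loses nothing, as a set of trials has at most [n]
   elements. *)
rewrite (partition_big (fun J : {set 'I_n} => inord #|J| : 'I_n.+1) (fun j => (k <= j)%N))/=; last first.
  move=> J; rewrite inordK// ltnS; by apply: leq_trans (max_card _) _; rewrite card_ord.
rewrite binomial_tail_ordE; apply: eq_bigr => j kj.
rewrite (eq_bigl (fun J : {set 'I_n} => J \in [set A : {set 'I_n} | #|A| == j]%SET)).
  rewrite (eq_bigr (fun=> p ^+ j * (1 - p) ^+ (n - j))); last by move=> J; rewrite inE => /eqP ->.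
  by rewrite sumr_const card_draws card_ord.
move=> J; rewrite inE -(inj_eq val_inj)/= inordK; last first.
  by rewrite ltnS; apply: leq_trans (max_card _) _; rewrite card_ord.
by case: eqP => [->|]; rewrite ?kj ?andbF.
Qed.

End binomial_tail.

(* E is a union of fibers of the finitely-valued map g. *)
Lemma measurable_saturated d (T : measurableType d) (U : finType) (g : T -> U) (E : set T) :
  (forall u, measurable (g @^-1` [set u])) ->
  (forall w w', g w = g w' -> E w -> E w') -> measurable E.
Proof.
move=> mg Esat.
have -> : E = \bigcup_(u in [set u | exists2 w, E w & g w = u]) (g @^-1` [set u]).
  apply/seteqP; split=> [w Ew|w [u [w' Ew' <-]] /= /esym gw]; first by exists (g w) => //; exists w.
  exact: Esat gw Ew'.
exact: fin_bigcup_measurable.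
Qed.

Lemma measure_fibers d (T : measurableType d) (R : realType)
    (P : {measure set T -> \bar R}) (U : finType) (g : T -> U) (E : set T) :
  (forall u, measurable (g @^-1` [set u])) -> measurable E ->
  P E = (\sum_(u : U) P (E `&` g @^-1` [set u]))%E.
Proof.
move=> mg mE.
have -> : P E = P (\bigcup_(u in [set: U]) (E `&` g @^-1` [set u])).
  congr (P _); apply/seteqP; split=> [w Ew|w [u _ []]//].
  by exists (g w).
rewrite measure_fin_bigcup//.
- rewrite (fsbigE (index_enum U))//.
  + by apply: eq_bigl => u; rewrite in_setT.
  + exact: index_enum_uniq.
  + by move=> u _; rewrite mem_index_enum.
- exact: finite_finset.
- by move=> u v _ _ [w [[_ /= <-] [_ /= <-]]].
- by move=> u _; exact: measurableI.
Qed.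

(** * Events generated by finitely many labelled samples *)

Section sampling.
Context (R : realType) (disp disp' : measure_display) (Omega : measurableType disp)
  (T : measurableType disp') (P : probability Omega R).
Local Open Scope ereal_scope.

Lemma sigma_generated_measurable (I : Type) (X : I -> {RV P >-> T}) A :
  sigma_generated X A -> measurable A.
Proof.
apply: smallest_sub; first exact: sigma_algebra_measurable.
move=> B [i _ [C mC <-]]; rewrite setTI -[X in measurable X]setTI.
exact: (measurable_funP (X i)).
Qed.

Lemma sigma_generated_preimage (I : Type) (X : I -> {RV P >-> T}) i A :
  measurable A -> sigma_generated X (X i @^-1` A).
Proof.
by move=> mA; apply: sub_sigma_algebra; exists i => //; exists A => //; rewrite setTI.
Qed.

(** The saturation argument run inside the sigma-algebra generated by [X], which makes such events
    available to the independence hypothesis. *)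
Lemma sigma_generated_saturated (I : Type) (X : I -> {RV P >-> T}) (U : finType)
    (g : Omega -> U) (E : set Omega) :
  (forall u, sigma_generated X (g @^-1` [set u])) ->
  (forall w w', g w = g w' -> E w -> E w') -> sigma_generated X E.
Proof. exact: (@measurable_saturated _ (g_sigma_algebraType _)). Qed.

(** A finitely-valued record of a batch of draws. Counts, chosen labels and bounds factor through
    it, so their measurability reduces to that of its fibers. *)
Definition labels (L : finType) (N : nat) (f : T -> L) (e : 'I_N -> {RV P >-> T})
  (w : Omega) : {ffun 'I_N -> L} := [ffun i => f (e i w)].

Lemma labels_fiber (L : finType) (N : nat) (f : T -> L) (e : 'I_N -> {RV P >-> T}) u :
  labels f e @^-1` [set u] = \bigcap_(i in [set: 'I_N]) (e i @^-1` (f @^-1` [set u i])).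
Proof.
apply/seteqP; split=> [w /= <- i _ /=|w h]; first by rewrite ffunE.
by apply/ffunP => i; rewrite ffunE; exact: h.
Qed.

(** The reindexing [k] lets a batch be seen as one side of a joined family. *)
Lemma sigma_generated_labels (I : Type) (X : I -> {RV P >-> T}) (L : finType) (N : nat)
    (k : 'I_N -> I) (f : T -> L) u :
  (forall c, measurable (f @^-1` [set c])) ->
  sigma_generated X (labels f (X \o k) @^-1` [set u]).
Proof.
move=> mf; rewrite labels_fiber.
apply: (@fin_bigcap_measurable _ (g_sigma_algebraType _)); first exact: finite_finset.
by move=> i _; exact: sigma_generated_preimage.
Qed.

(** Split by the set [J] of successful draws; independence gives a factor [p] for each index in [J]
    and [1 - p] for each index outside. *)
Lemma count_binomial_tail (N k : nat) (p : R) (f : pred T) (e : 'I_N -> {RV P >-> T}) :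
  measurable [set v | f v] -> mutually_independent e ->
  (forall i, P (e i @^-1` [set v | f v]) = p%:E) ->
  P [set w | (k <= #|[set i | f (e i w)]%SET|)%N] = (binomial_tail N k p)%:E.
Proof.
move=> mf ind Pp; rewrite binomial_tail_setE.
pose g w : {set 'I_N} := [set i | f (e i w)]%SET.
have mff b : measurable [set v | f v = b].
  case: b => //; rewrite (_ : [set v | _] = ~` [set v | f v]); first exact: measurableC.
  by apply/seteqP; split=> v /=; case: (f v).
(* The events [f v = (i \in J)] encode success and failure at once, so independence is used a single
   time over all indices. *)
have gE J : g @^-1` [set J] =
    \bigcap_(i in [set` [set: 'I_N]%SET]) (e i @^-1` [set v | f v = (i \in J)]).
  apply/seteqP; split=> [w /= <- i _|w h]; first by rewrite /g /= inE.
  by apply/setP => i; rewrite inE; apply: h => /=; rewrite inE.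
have me i b : measurable (e i @^-1` [set v | f v = b]).
  by rewrite -[X in measurable X]setTI; exact: (measurable_funP (e i)).
have mg J : measurable (g @^-1` [set J]).
  by rewrite gE; apply: fin_bigcap_measurable => //; exact: finite_finset.
have PJ J : P (g @^-1` [set J]) = (p ^+ #|J| * (1 - p) ^+ (N - #|J|))%:E.
  rewrite gE ind// (eq_bigl predT); last by move=> i; rewrite inE.
  rewrite (bigID (mem J))/= (eq_bigr (fun=> p%:E)); last first.
    by move=> i iJ; rewrite iJ -(Pp i).
  rewrite [X in _ * X](eq_bigr (fun=> (1 - p)%:E)); last first.
    move=> i /negbTE iJ; rewrite iJ.
    rewrite (_ : e i @^-1` _ = ~` (e i @^-1` [set v | f v])).
      by rewrite probability_setC ?Pp//; exact: (me i true).
    by apply/seteqP; split=> w /=; case: (f _).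
  rewrite !prodEFin -EFinM !prodr_const; congr (_ * _ ^+ _)%:E.
  apply/eqP; rewrite -(eqn_add2l #|J|) subnKC; first by rewrite -[X in _ == X](card_ord N) cardC.
  by rewrite -[X in (_ <= X)%N](card_ord N) max_card.
rewrite (@measure_fibers _ _ _ P _ g)//; last first.
  apply: (measurable_saturated (g := g)) => // w w'.
  by rewrite /g /= => ->.
rewrite -sumEFin [RHS]big_mkcond; apply: eq_bigr => J _.
case: ifPn => [kJ|kJ].
  rewrite -PJ; congr (P _); apply/seteqP; split=> [w []//|w /= gw].
  by split => //; rewrite -/(g w) gw.
rewrite (_ : _ `&` _ = set0) ?measure0//.
by apply/seteqP; split=> // w [/= kw gw]; move: kw; rewrite -/(g w) gw (negbTE kJ).
Qed.

(* Clopper-Pearson coverage, in the sharp form lcb >= p; restricting to lcb >= 1/2 discards the default value 0. *)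
Lemma lower_conf_bnd_coverage (N : nat) (p beta : R) (f : pred T) (e : 'I_N -> {RV P >-> T}) :
  (0 <= beta)%R -> (0 <= p)%R ->
  measurable [set v | f v] -> mutually_independent e ->
  (forall i, P (e i @^-1` [set v | f v]) = p%:E) ->
  P [set w | (2^-1 <= lower_conf_bnd #|[set i | f (e i w)]%SET| N (1 - beta) /\
              p <= lower_conf_bnd #|[set i | f (e i w)]%SET| N (1 - beta))%R] <= beta%:E.
Proof.
move=> b0 p0 mf ind Pp.
pose bad k := (2^-1 <= lower_conf_bnd k N (1 - beta))%R && (p <= lower_conf_bnd k N (1 - beta))%R.
have [[k0 bk0]|nobad] := pselect (exists k, bad k); last first.
  rewrite (_ : [set w | _] = set0) ?measure0 ?lee_fin//.
  by apply/seteqP; split=> // w [h1 h2]; apply: nobad; eexists; rewrite /bad; apply/andP; split; eassumption.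
have exbad : exists k, bad k by exists k0.
case: (ex_minnP exbad) => k bk kmin.
have tail_le : (binomial_tail N k p <= beta)%R.
  (* A zero count and the default of [xget] both give the bound 0, contradicting [bad]; what is left
     is a genuine root [q >= p] whose tail equals [beta]. *)
  move: bk; rewrite /bad /lower_conf_bnd; case: eqP => [_ /andP[]|_].
    by rewrite leNgt invr_gt0 ltr0n.
  set Q := [set _ | _]; set q := xget 0%R Q.
  have [[q01]|->] : Q q \/ q = 0%R; last by rewrite leNgt invr_gt0 ltr0n.
    by rewrite /q; case: xgetP => [y _ Qy|_]; [left|right].
  have /andP[q0 q1] := q01.
  rewrite binomial_prob_tail; last by rewrite !ltW.
  rewrite subKr => -[<-] /andP[_ pq].
  by apply: binomial_tail_mono => //; exact: ltW.
apply: (@le_trans _ _ (binomial_tail N k p)%:E); last by rewrite lee_fin.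
rewrite -(count_binomial_tail k mf ind Pp).
pose g w : {set 'I_N} := [set i | f (e i w)]%SET.
have mE (D : pred nat) : measurable [set w | D #|g w|].
  apply: (measurable_saturated (g := labels f e)) => [u|w w' ww'].
    apply: (@sigma_generated_measurable _ e).
    apply: (@sigma_generated_labels _ e _ _ id) => b.
    case: b => //; rewrite (_ : _ @^-1` _ = ~` [set v | f v]); first exact: measurableC.
    by apply/seteqP; split=> v /=; case: (f v).
  rewrite /= (_ : g w' = g w)//; apply/setP => i; rewrite !inE.
  by have /ffunP/(_ i) := ww'; rewrite !ffunE.
apply: le_measure; rewrite ?inE.
- rewrite (_ : [set w | _] = [set w | bad #|g w|]); first exact: mE.
  by apply/seteqP; split=> w /= => [[h1 h2]|/andP[h1 h2]]; [apply/andP|].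
- exact: (mE (fun j => (k <= j)%N)).
- by move=> w [h1 h2]; apply: kmin; apply/andP.
Qed.

End sampling.

(** * Soundness of the certificate *)

Section selection.
Context (R : realType) (disp disp' : measure_display) (Omega : measurableType disp)
  (T : measurableType disp') (P : probability Omega R) (I J : Type)
  (X : I -> {RV P >-> T}) (Y : J -> {RV P >-> T}) (L : finType)
  (sel : Omega -> L) (B : L -> set Omega).
Hypothesis sel_fiber : forall c, sigma_generated X (sel @^-1` [set c]).
Hypothesis B_sigma : forall c, sigma_generated Y (B c).
Local Open Scope ereal_scope.

Lemma measurable_selected : measurable [set w | B (sel w) w].
Proof.
rewrite (_ : [set w | _] = \bigcup_(c in [set: L]) (sel @^-1` [set c] `&` B c)).
  apply: fin_bigcup_measurable => [|c _]; first exact: finite_finset.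
  by apply: measurableI; exact: sigma_generated_measurable.
by apply/seteqP; split=> [w Bw|w [c _ [/= <-]]//]; exists (sel w).
Qed.

(** A uniform bound over fixed labels survives an independent random choice: each term is at most
    [b] times the probability of selecting [c], and these probabilities sum to 1. *)
Lemma probability_selected_le (b : R) : independent_families X Y ->
  (forall c, P (B c) <= b%:E) -> P [set w | B (sel w) w] <= b%:E.
Proof.
move=> ind PB.
have msel c : measurable (sel @^-1` [set c]) by exact: sigma_generated_measurable (sel_fiber c).
rewrite (@measure_fibers _ _ _ P _ sel) //; last exact: measurable_selected.
apply: (@le_trans _ _ (\sum_c P (sel @^-1` [set c]) * b%:E)).
  apply: lee_sum => c _.
  apply: (@le_trans _ _ (P (sel @^-1` [set c]) * P (B c))); last by rewrite lee_wpmul2l.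
  have <- := ind _ _ (sel_fiber c) (B_sigma c).
  rewrite (_ : _ `&` _ = sel @^-1` [set c] `&` B c)//.
  by apply/seteqP; split=> w /= [h1 h2]; split=> //; [rewrite -h2|rewrite h1].
rewrite -ge0_sume_distrl; last by move=> c _.
have := @measure_fibers _ _ _ P _ sel setT msel measurableT.
under eq_bigr do rewrite setTI.
by move=> <-; rewrite [X in X * _](_ : _ = 1) ?mul1e//; exact: (probability_setT P).
Qed.

End selection.

Section soundness.
Variables (R : realType) (d m : nat) (s : R).
Hypothesis s0 : 0 < s.

Lemma measurable_classifier_shift (L : finType) (F : 'rV[R]_d -> L) (x : 'rV[R]_d) (C : set L) :
  measurable_classifier F -> measurable [set e : 'rV[R]_d | C (F (x + e))].
Proof.
move=> mF; rewrite -[X in measurable X]setTI.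
have -> : [set e : 'rV[R]_d | C (F (x + e))] = (fun e => e + x) @^-1` (F @^-1` C).
  by apply/seteqP; split=> e /=; rewrite addrC.
exact: measurable_rV_shift.
Qed.

(** Disjoint events have total mass at most 1, so a label above 1/2 is the unique maximiser and tie
    breaking has no choice. *)
Lemma smoothed_majority (L : finType) (tie : {set L} -> L) (F : 'rV[R]_d -> L) y c :
  tie_breaking tie -> measurable_classifier F ->
  ((2^-1)%:E < isotropic_gaussian s d [set e | F (y + e)%R = c])%E ->
  smoothed s tie F y = c.
Proof.
move=> htie mF hc.
pose score := fun c' => isotropic_gaussian s d [set e : 'rV[R]_d | F (y + e) = c'].
rewrite /smoothed -/score /argmax_label.
have mE c' : measurable [set e : 'rV[R]_d | F (y + e) = c'].
  exact: (@measurable_classifier_shift _ F y [set c']).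
have lt_score c' : c' != c -> (score c' < score c)%E.
  move=> c'c; apply: (le_lt_trans _ hc).
  have h : (score c' + score c <= 1)%E.
    rewrite -measureU//; last first.
      by apply/seteqP; split=> // e [/= -> ce]; rewrite ce eqxx in c'c.
    by apply: probability_le1; exact: measurableU.
  have f1 : score c' \is a fin_num by exact: fin_num_measure.
  have f2 : score c \is a fin_num by exact: fin_num_measure.
  move: h hc; rewrite -/(score c) -(fineK f1) -(fineK f2) -EFinD !lee_fin !lte_fin.
  lra.
have -> : [set c0 | [forall c', (score c' <= score c0)%O]]%SET = [set c]%SET.
  apply/setP => c0; rewrite !inE; apply/forallP/eqP => [h|-> c'].
    by apply/eqP; apply: contraTT (h c) => c0c; rewrite -ltNge lt_score.
  by have [->//|c'c] := eqVneq c' c; exact: ltW (lt_score _ c'c).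
have := htie [set c]%SET; rewrite -cards_eq0 cards1 => /(_ isT).
by rewrite inE => /eqP.
Qed.

(** Smoothing at [x + delta] measures a translate of the event at [x], to which the half-space bound
    applies with [z] the quantile of [p]. *)
Lemma smoothed_certified (L : finType) (tie : {set L} -> L) (F : 'rV[R]_d -> L)
    x delta c (p : R) :
  tie_breaking tie -> measurable_classifier F -> 2^-1 < p ->
  (p%:E < isotropic_gaussian s d [set e | F (x + e)%R = c])%E ->
  l2norm delta <= s * std_normal_quantile p ->
  smoothed s tie F (x + delta) = c.
Proof.
move=> htie mF p2 pc; rewrite /std_normal_quantile.
have mE : measurable [set e : 'rV[R]_d | F (x + e) = c].
  exact: (@measurable_classifier_shift _ F x [set c]).
case: xgetP => [z _ /= zp|_].
  move=> hz; apply: smoothed_majority => //.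
  rewrite (_ : [set e | _] = [set v | [set e | F (x + e) = c] (v + delta)]).
    by apply: (isotropic_gaussian_shift_gt_half s0 mE hz); rewrite zp.
  by apply/seteqP; split=> v /=; rewrite -addrA [delta + v]addrC.
(* The default quantile 0 gives radius 0, hence a zero shift, and a mass above 1/2 suffices
   there. *)
rewrite mulr0 => h; have -> : delta = 0.
  by apply: l2norm_eq0; apply/eqP; rewrite eq_le h sqrtr_ge0.
rewrite addr0; apply: smoothed_majority => //.
by apply: lt_trans pc; rewrite lte_fin.
Qed.

Definition label_prob (L : finType) (F : 'rV[R]_d -> L) (x : 'rV[R]_d) (c : L) : R :=
  fine (isotropic_gaussian s d [set e | F (x + e) = c]).

Lemma label_probE (L : finType) (F : 'rV[R]_d -> L) x c : measurable_classifier F ->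
  (isotropic_gaussian s d [set e | F (x + e)%R = c] = (label_prob F x c)%:E)%E.
Proof.
move=> mF; rewrite /label_prob fineK// fin_num_measure//.
exact: (@measurable_classifier_shift _ F x [set c]).
Qed.

Definition selected_label (k : 'I_2 -> nat) : 'I_2 :=
  if (k ord0 > k ord_max)%N then ord0 else ord_max.

(** Purely deterministic: the two negated conditions say that a bound reaching 1/2 lies strictly
    below the true probability of its label. *)
Lemma certify_sound (FSelect : 'rV[R]_d -> 'I_2) (FCertify FCore : 'rV[R]_d -> 'I_m)
    (tieS : {set 'I_2} -> 'I_2) (tieC tieA : {set 'I_m} -> 'I_m) (x : 'rV[R]_d)
    (n0 n : nat) (alpha : R) (eS0 eC0 : 'I_n0 -> 'rV[R]_d) (eS eC : 'I_n -> 'rV[R]_d) :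
  measurable_classifier FSelect -> measurable_classifier FCertify ->
  tie_breaking tieS -> tie_breaking tieC ->
  let s_hat := selected_label (sample_counts FSelect x eS0) in
  let c_hat := argmax_label tieA (sample_counts FCertify x eC0) in
  let pS := lower_conf_bnd (sample_counts FSelect x eS s_hat) n (1 - alpha / 2) in
  let pA := lower_conf_bnd (sample_counts FCertify x eC c_hat) n (1 - alpha / 2) in
  ~ (2^-1 <= pS /\ label_prob FSelect x s_hat <= pS) ->
  ~ (2^-1 <= pA /\ label_prob FCertify x c_hat <= pA) ->
  let out := certify s tieA FSelect FCertify FCore x alpha eS0 eC0 eS eC in
  out.1 = None \/
  forall delta : 'rV[R]_d, l2norm delta <= out.2 ->
    Some (aces s tieS tieC FSelect FCertify FCore (x + delta)) = omap (@label m) out.1.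
Proof.
move=> mS mC htS htC s_hat c_hat pS pA goodS goodA.
have ltS : 2^-1 <= pS -> pS < label_prob FSelect x s_hat.
  by move=> h; rewrite ltNge; apply/negP => h'; exact: goodS.
have ltA : 2^-1 <= pA -> pA < label_prob FCertify x c_hat.
  by move=> h; rewrite ltNge; apply/negP => h'; exact: goodA.
have delta0 (delta : 'rV[R]_d) : l2norm delta <= 0 -> delta = 0.
  by move=> h; apply: l2norm_eq0; apply/eqP; rewrite eq_le h sqrtr_ge0.
rewrite /certify -/(selected_label (sample_counts FSelect x eS0)).
rewrite -/s_hat -/c_hat -/pS -/pA.
case: ifP => [/andP[/eqP shat1]|_].
  rewrite lt_min => /andP[pA2 pS2]; right => delta /= hdelta.
  (* The radius comes from the smaller bound, so it covers selector and certifier for the same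
     [delta]. *)
  have minP : 2^-1 < Num.min pA pS by rewrite lt_min pA2.
  rewrite /aces (smoothed_certified (c := ord_max) htS mS minP _ hdelta); last first.
    by rewrite label_probE// lte_fin -shat1 gt_min ltS ?orbT// ltW.
  rewrite (smoothed_certified (c := c_hat) htC mC minP _ hdelta) ?mul1n ?mul0n ?addn0//.
  by rewrite label_probE// lte_fin gt_min ltA// ltW.
case: ifP => [/andP[/eqP shat0 pS2]|_].
  right => delta /= /delta0 ->; rewrite addr0 /aces (@smoothed_majority _ _ _ _ ord0)//.
    by rewrite mul0n add0n subn0 mul1n.
  by rewrite label_probE// lte_fin -shat0 (le_lt_trans pS2)// ltS.
case: ifP => [/andP[/eqP cF pA2]|_]; last by left.
right => delta /= /delta0 ->; rewrite addr0 /aces (@smoothed_majority _ tieC _ _ c_hat)//; last first.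
  by rewrite label_probE// lte_fin (le_lt_trans pA2)// ltA.
(* The smoothed selector is unknown here, but certifier and core agree at [x]; its value is at most
   1, so the truncated weights sum to 1. *)
rewrite -cF -mulnDl; congr Some.
by rewrite subnKC ?mul1n// -ltnS ltn_ord.
Qed.

End soundness.

(** * Coverage failures in the second round and the union bound *)

Section failure.
Context (R : realType) (d : nat) (s : R) (L : finType) (F : 'rV[R]_d -> L) (x : 'rV[R]_d)
  (disp : measure_display) (Omega : measurableType disp) (P : probability Omega R).
Hypothesis mF : measurable_classifier F.

(** The label [c] is a parameter: the event is bounded for each fixed label before the first-round
    choice is substituted. *)
Definition coverage_failure (N : nat) (beta : R) (e : 'I_N -> {RV P >-> 'rV[R]_d}) (c : L) :
    set Omega :=
  [set w | let p := lower_conf_bnd (sample_counts F x (e ^~ w) c) N (1 - beta) in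
           2^-1 <= p /\ label_prob s F x c <= p].

Lemma sample_counts_labels (N : nat) (e : 'I_N -> {RV P >-> 'rV[R]_d}) w w' :
  labels (fun v => F (x + v)) e w = labels (fun v => F (x + v)) e w' ->
  sample_counts F x (e ^~ w) = sample_counts F x (e ^~ w').
Proof.
move=> /ffunP ww'; apply/funext => c; apply: eq_card => i; rewrite !inE.
by have := ww' i; rewrite !ffunE => ->.
Qed.

Lemma sigma_generated_classifier_labels (I : Type) (X : I -> {RV P >-> 'rV[R]_d}) (N : nat)
    (k : 'I_N -> I) u :
  sigma_generated X (labels (fun v => F (x + v)) (X \o k) @^-1` [set u]).
Proof.
apply: sigma_generated_labels => c.
exact: (@measurable_classifier_shift _ _ _ F x [set c]).
Qed.

Lemma coverage_failure_le (N : nat) (beta : R) (e : 'I_N -> {RV P >-> 'rV[R]_d}) c :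
  0 <= beta -> iid_gaussian s e -> (P (coverage_failure beta e c) <= beta%:E)%E.
Proof.
move=> b0 [ind law].
have mc : measurable [set v : 'rV[R]_d | F (x + v) == c].
  rewrite (_ : [set v | _] = [set v | [set c] (F (x + v))]).
    exact: (measurable_classifier_shift x [set c] mF).
  by apply/seteqP; split=> v /= /eqP.
apply: (@lower_conf_bnd_coverage _ _ _ _ _ P N (label_prob s F x c) beta
  (fun v => F (x + v) == c) e b0) => //.
  exact/fine_ge0/measure_ge0.
move=> i; rewrite -label_probE//.
transitivity (isotropic_gaussian s d [set v | F (x + v) == c]); first exact: (law i _ mc).
by congr (isotropic_gaussian s d _); apply/seteqP; split=> v /= /eqP.
Qed.

Lemma coverage_failure_sigma (I : Type) (X : I -> {RV P >-> 'rV[R]_d}) (N : nat) (k : 'I_N -> I)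
    (beta : R) c :
  sigma_generated X (coverage_failure beta (X \o k) c).
Proof.
apply: (sigma_generated_saturated (g := labels (fun v => F (x + v)) (X \o k))).
  exact: sigma_generated_classifier_labels.
by move=> w w' /sample_counts_labels ww'; rewrite /coverage_failure /= ww'.
Qed.

End failure.

Theorem theoremB1 (R : realType) (d m n0 n : nat) (sigma alpha : R)
  (FSelect : 'rV[R]_d -> 'I_2) (FCertify FCore : 'rV[R]_d -> 'I_m)
  (tieS : {set 'I_2} -> 'I_2) (tieC tieA : {set 'I_m} -> 'I_m)
  (x : 'rV[R]_d)
  (disp : measure_display) (Omega : measurableType disp)
  (P : probability Omega R)
  (eS0 eC0 : 'I_n0 -> {RV P >-> 'rV[R]_d})
  (eS eC : 'I_n -> {RV P >-> 'rV[R]_d}) :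
  measurable_classifier FSelect ->
  measurable_classifier FCertify ->
  measurable_classifier FCore ->
  tie_breaking tieS -> tie_breaking tieC -> tie_breaking tieA ->
  0 < sigma -> 0 < alpha < 1 -> (1 <= n0)%N -> (1 <= n)%N ->
  iid_gaussian sigma eS0 -> iid_gaussian sigma eC0 ->
  iid_gaussian sigma eS -> iid_gaussian sigma eC ->
  independent_families (join_families eS0 eC0) (join_families eS eC) ->
  ((1 - alpha)%:E <= P [set w : Omega |
     let out := certify sigma tieA FSelect FCertify FCore x alpha
       (eS0 ^~ w) (eC0 ^~ w) (eS ^~ w) (eC ^~ w) in
     out.1 = None \/
     forall delta : 'rV[R]_d, (l2norm delta <= out.2)%R ->
       Some (aces sigma tieS tieC FSelect FCertify FCore (x + delta)%R) =
       omap (@label m) out.1])%E.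
Proof.
move=> mS mC _ htS htC _ s0 /andP[a0 _] _ _ _ _ iS iC ind.
set E := [set w | _].
(* The batches of a round are the [inl] and [inr] parts of its joined family. *)
have sigma0S := @sigma_generated_classifier_labels _ _ _ FSelect x _ _ P mS _ (join_families eS0 eC0) n0 inl.
have sigma0C := @sigma_generated_classifier_labels _ _ _ FCertify x _ _ P mC _ (join_families eS0 eC0) n0 inr.
have sigma1S := @sigma_generated_classifier_labels _ _ _ FSelect x _ _ P mS _ (join_families eS eC) n inl.
have sigma1C := @sigma_generated_classifier_labels _ _ _ FCertify x _ _ P mC _ (join_families eS eC) n inr.
pose s_hat w := selected_label (sample_counts FSelect x (eS0 ^~ w)).
pose c_hat w := argmax_label tieA (sample_counts FCertify x (eC0 ^~ w)).
have s_hat_sigma c : sigma_generated (join_families eS0 eC0) (s_hat @^-1` [set c]).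
  apply: (sigma_generated_saturated (g := labels (fun v => FSelect (x + v)) eS0)) => [|w w'].
    exact: sigma0S.
  by move=> /sample_counts_labels ww'; rewrite /s_hat /= ww'.
have c_hat_sigma c : sigma_generated (join_families eS0 eC0) (c_hat @^-1` [set c]).
  apply: (sigma_generated_saturated (g := labels (fun v => FCertify (x + v)) eC0)) => [|w w'].
    exact: sigma0C.
  by move=> /sample_counts_labels ww'; rewrite /c_hat /= ww'.
have failS_sigma c : sigma_generated (join_families eS eC)
    (coverage_failure sigma FSelect x (alpha / 2) eS c).
  exact: (@coverage_failure_sigma _ _ _ _ _ _ _ _ P mS _ (join_families eS eC) n inl).
have failC_sigma c : sigma_generated (join_families eS eC)
    (coverage_failure sigma FCertify x (alpha / 2) eC c).
  exact: (@coverage_failure_sigma _ _ _ _ _ _ _ _ P mC _ (join_families eS eC) n inr).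
(* Failures at the labels actually picked in the first round. *)
pose BS := [set w | coverage_failure sigma FSelect x (alpha / 2) eS (s_hat w) w].
pose BC := [set w | coverage_failure sigma FCertify x (alpha / 2) eC (c_hat w) w].
have a2 : 0 <= alpha / 2 by lra.
have mBS : measurable BS := measurable_selected s_hat_sigma failS_sigma.
have mBC : measurable BC := measurable_selected c_hat_sigma failC_sigma.
have PBS : (P BS <= (alpha / 2)%:E)%E.
  by apply: (probability_selected_le s_hat_sigma failS_sigma ind) => c; exact: coverage_failure_le.
have PBC : (P BC <= (alpha / 2)%:E)%E.
  by apply: (probability_selected_le c_hat_sigma failC_sigma ind) => c; exact: coverage_failure_le.
(* [E] quantifies over all shifts, yet depends on the sample point only through four finite label
   records, so it is a union of their fibers. *)
have mE : measurable E.
  pose g w := (labels (fun v => FSelect (x + v)) eS0 w, labels (fun v => FCertify (x + v)) eC0 w,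
    labels (fun v => FSelect (x + v)) eS w, labels (fun v => FCertify (x + v)) eC w).
  apply: (@measurable_saturated _ _ _ g) => [[[[u1 u2] u3] u4]|w w'].
    rewrite (_ : g @^-1` _ = labels (fun v => FSelect (x + v)) eS0 @^-1` [set u1] `&`
        labels (fun v => FCertify (x + v)) eC0 @^-1` [set u2] `&`
        labels (fun v => FSelect (x + v)) eS @^-1` [set u3] `&`
        labels (fun v => FCertify (x + v)) eC @^-1` [set u4]); last first.
      by apply/seteqP; split=> [w [<- <- <- <-]//|w [[[/= <- <-] <-] <-]].
    apply: measurableI; first apply: measurableI; first apply: measurableI.
    - exact: sigma_generated_measurable (sigma0S u1).
    - exact: sigma_generated_measurable (sigma0C u2).
    - exact: sigma_generated_measurable (sigma1S u3).
    - exact: sigma_generated_measurable (sigma1C u4).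
  case=> /sample_counts_labels e1 /sample_counts_labels e2 /sample_counts_labels e3
    /sample_counts_labels e4.
  by rewrite /E /certify /= e1 e2 e3 e4.
have subE : ~` (BS `|` BC) `<=` E.
  move=> w /not_orP[nBS nBC].
  apply: (certify_sound s0 FCore mS mC htS htC); [exact: nBS|exact: nBC].
(* Each of the two failures costs at most [alpha / 2]. *)
apply: (@le_trans _ _ (P (~` (BS `|` BC)))); last first.
  by apply: le_measure; rewrite ?inE//; apply: measurableC; exact: measurableU.
rewrite probability_setC; last exact: measurableU.
rewrite EFinB leeB//.
apply: (le_trans (measureU2 P mBS mBC)).
by rewrite (splitr alpha) EFinD leeD.
Qed.
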